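(* Let $T\in(0,\infty]$. Then, for every $x_0\in\mathbb{R}^n$, $(OCP)^{lim}_T$ admits a minimizer in $L^\infty([0,T),[-1,1])$, and $V^{lim}_T$ is a positive definite convex function on $\mathbb{R}^n$. If, in addition, $F$ is strictly convex, then for every $x_0\in\mathbb{R}^n$ the problem $(OCP)^{lim}_T$ has a unique minimizer, and $V^{lim}_T$ is strictly convex.
   Context: Let $n\ge1$ be an integer, $J_n$ the $n\times n$ Jordan block with eigenvalue $0$ (ones on the superdiagonal, zeros elsewhere) and $e_n$ the last canonical basis vector of $\mathbb{R}^n$. The control system is $\dot x=J_nx+e_nu$. The function $F:\mathbb{R}^n\to\mathbb{R}_{\ge0}$ is continuously differentiable, convex and positive definite ($F(0)=0$, $F(x)>0$ for $x\ne0$). For $T\in(0,\infty]$, $x_0\in\mathbb{R}^n$ and $u\in L^\infty([0,T),[-1,1])$ (measurable functions with values in $[-1,1]$), set $\mathcal{K}_T(x_0,u)=\int_0^TF(x(t))\,dt$, where $x(\cdot)$ is the trajectory of the control system with $x(0)=x_0$ and control $u$. $(OCP)^{lim}_T$ is the problem of minimizing $\mathcal{K}_T(x_0,u)$ over $u\in L^\infty([0,T),[-1,1])$, and $V^{lim}_T(x_0)=\inf_{u\in L^\infty([0,T),[-1,1])}\mathcal{K}_T(x_0,u)$ is its value function. *)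

(* Defs.v *)
From HB Require Import structures.
From mathcomp Require Import all_boot all_order all_algebra.
From mathcomp Require Import all_classical all_reals all_analysis.

Set Implicit Arguments.
Unset Strict Implicit.
Unset Printing Implicit Defensive.

Import Order.TTheory GRing.Theory Num.Theory.
Import numFieldNormedType.Exports.

Local Open Scope classical_set_scope.
Local Open Scope ring_scope.

Section functions_on_Rn.
Context {R : realType} {n : nat}.
Implicit Type f : 'cV[R]_n -> R.

Definition gradient f (x : 'cV[R]_n) : 'cV[R]_n :=
  \col_i 'd f x (delta_mx i 0).

Definition continuously_differentiable f : Prop :=
  (forall x, differentiable f x) /\ continuous (gradient f).

Definition positive_definite f : Prop :=
  f 0 = 0 /\ forall x, x != 0 -> 0 < f x.

Definition convex f : Prop := convex_function [set: 'cV[R]_n] f.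

Definition strictly_convex f : Prop :=
  forall (x y : 'cV[R]_n) (t : R), x != y -> 0 < t -> t < 1 ->
    f (t *: x + (1 - t) *: y) < t * f x + (1 - t) * f y.

End functions_on_Rn.

Section control_system.
Context {R : realType} {n : nat}.

Definition jordan_block : 'M[R]_n := \matrix_(i, j) (j == i.+1 :> nat)%:R.

(* The index of the last coordinate is n - 1; stated this way so that the
   vector makes sense without destructing n. *)
Definition last_basis_vector : 'cV[R]_n := \col_i (i.+1 == n)%:R.

(* The interval [0, T) of the real line, where T may be +oo. *)
Definition horizon (T : \bar R) : set R :=
  [set t | 0 <= t /\ (t%:E < T)%E].

(* Representatives of the elements of L^oo([0, T), [-1, 1]); they are
   identified up to almost everywhere equality on [0, T), and their values
   outside [0, T) are irrelevant. *)
Definition admissible (T : \bar R) (u : R -> R) : Prop :=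
  measurable_fun (horizon T) u /\
  forall t, horizon T t -> -1 <= u t <= 1.

Definition dynamics (x : 'cV[R]_n) (v : R) : 'cV[R]_n :=
  jordan_block *m x + v *: last_basis_vector.

(* Solutions in the sense of Caratheodory, in integral form. For admissible u
   the continuity of x makes the integrands bounded and measurable on each
   [0, t], so that the real-valued integrals are meaningful. *)
Definition is_trajectory (T : \bar R) (x0 : 'cV[R]_n) (u : R -> R)
    (x : R -> 'cV[R]_n) : Prop :=
  {within horizon T, continuous x} /\
  forall t, horizon T t -> forall i,
    x t i 0 = x0 i 0 +
      \int[lebesgue_measure]_(s in `[0, t]) (dynamics (x s) (u s) i 0).

(* For admissible u, the system being linear, a trajectory exists and is
   unique on [0, T); its values outside [0, T) are arbitrary. *)
Definition trajectory (T : \bar R) (x0 : 'cV[R]_n) (u : R -> R) :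
    R -> 'cV[R]_n :=
  get (is_trajectory T x0 u).

End control_system.

Section optimal_control_problem.
Context {R : realType} {n : nat}.
Variables (F : 'cV[R]_n -> R) (T : \bar R).

Definition cost (x0 : 'cV[R]_n) (u : R -> R) : \bar R :=
  (\int[lebesgue_measure]_(t in horizon T) (F (trajectory T x0 u t))%:E)%E.

Definition value (x0 : 'cV[R]_n) : \bar R :=
  ereal_inf [set cost x0 u | u in admissible T].

Definition is_minimizer (x0 : 'cV[R]_n) (u : R -> R) : Prop :=
  admissible T u /\
  forall v, admissible T v -> (cost x0 u <= cost x0 v)%E.

End optimal_control_problem.

(* Main.v *)
(* The system is a chain of integrators, so the trajectory is an explicit iterated
   primitive of the control and depends linearly on the pair (initial state,
   control); hence the cost is jointly convex in that pair.  A polynomial transfer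
   to the origin, slowed down enough for its n-th derivative to be bounded by 1,
   shows that the value is finite even when the horizon is infinite.

   A minimizer is found without weak compactness.  The controls of cost at most
   V + 1/(m+1) form a decreasing sequence of convex sets; choosing in them
   elements of nearly minimal weighted L^2 norm, the parallelogram identity makes
   consecutive differences summable, so the chosen controls converge almost
   everywhere.  Dominated convergence transfers this to the trajectories, and
   Fatou's lemma bounds the cost of the limit by V.

   Equality in a convexity inequality for the cost forces equality for the
   running cost at every time, the integrands being continuous.  At time 0 this
   gives strict convexity of the value; at all times it gives equality of two
   optimal trajectories, hence of the controls, by Lebesgue differentiation. *)

Require Import Defs.
From mathcomp Require Import all_boot all_order all_algebra.
From mathcomp Require Import all_classical all_reals all_analysis.
From mathcomp Require Import measurable_realfun ring lra zify.

Set Implicit Arguments.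
Unset Strict Implicit.
Unset Printing Implicit Defensive.

Import Order.TTheory GRing.Theory Num.Theory.
Import numFieldNormedType.Exports.
Local Open Scope classical_set_scope.
Local Open Scope ring_scope.

(** * Iterated primitives of bounded controls *)

Section Chain.
Context {R : realType}.
Local Notation mu := (@lebesgue_measure R).
Implicit Types (f u v : R -> R) (c d : nat -> R).

(** Controls and all their iterated primitives belong to this class, whose members are integrable on
    compact intervals. *)
Definition locally_bounded_measurable f :=
  measurable_fun setT f /\
  forall N : R, exists M : R, forall s, `|s| <= N -> `|f s| <= M.

Lemma integrable_itvcc f (a b : R) : locally_bounded_measurable f ->
  mu.-integrable `[a, b] (EFin \o f).
Proof.
move=> [mf bf]; apply: measurable_bounded_integrable => //.
- rewrite /= lebesgue_measure_itv /=; case: ifPn => // _.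
  by rewrite -EFinB ltry.
- exact: measurable_funTS.
- have [M fM] := bf (`|a| + `|b|).
  exists M; split; first exact: num_real.
  move=> x Mx s /=; rewrite in_itv /= => /andP[aS sb].
  apply: le_trans (fM s _) (ltW Mx).
  have := ler_norm b; have := ler_norm (- a); rewrite normrN => ha hb.
  have := normr_ge0 a; have := normr_ge0 b => ? ?.
  by rewrite ler_norml; apply/andP; split; lra.
Qed.

(** For negative [t] the interval is empty, so the value is 0 and not the oriented integral;
    continuity on the whole line survives. *)
Definition primitive f t := \int[mu]_(s in `[0, t]) f s.

Lemma primitive_le0 f t : t <= 0 -> primitive f t = 0.
Proof.
rewrite le_eqVlt => /predU1P[->|t0]; rewrite /primitive.
  by rewrite set_itv1 Rintegral_set1.
by rewrite set_itv_ge ?Rintegral_set0// bnd_simp -ltNge.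
Qed.

Lemma primitive_max f t : primitive f t = primitive f (Num.max 0 t).
Proof.
by have [t0|//] := leP t 0; rewrite !primitive_le0.
Qed.

Lemma primitive_lipschitz f (N M r s : R) : locally_bounded_measurable f ->
  (forall t, `|t| <= N -> `|f t| <= M) -> `|r| <= N -> `|s| <= N ->
  `|primitive f s - primitive f r| <= M * `|s - r|.
Proof.
move=> lf fM; wlog rs : r s / r <= s.
  move=> h rN sN; have /orP[|] := le_total r s => rs; first exact: h.
  by rewrite distrC (distrC s); exact: h.
move=> rN sN; have N0 : 0 <= N by apply: le_trans rN.
have M0 : 0 <= M by apply: le_trans (fM 0 _); rewrite ?normr0.
have [s0|s0] := leP s 0.
  rewrite !primitive_le0 ?subr0 ?normr0 ?mulr_ge0//; exact: le_trans s0.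
rewrite (primitive_max f r).
have r'0 : 0 <= Num.max 0 r by rewrite le_max lexx.
have r's : Num.max 0 r <= s by rewrite ge_max rs ltW.
have : `|s - Num.max 0 r| <= `|s - r|.
  by rewrite !ger0_norm ?subr_ge0// lerD2l lerN2 le_max lexx orbT.
move: (Num.max 0 r : R) r'0 r's => q q0 qs sq.
apply: le_trans (ler_wpM2l M0 sq).
have fs : mu.-integrable `[0, s] (EFin \o f) by exact: integrable_itvcc.
have qsI : mu.-integrable `]q, s] (EFin \o f).
  apply: integrableS fs => //; apply: subset_itvr; by rewrite bnd_simp.
rewrite /primitive Rintegral_itvB ?bnd_simp//.
apply: le_trans; first by apply: le_normr_Rintegral.
have -> : M * `|s - q| = \int[mu]_(t in `]q, s]) M.
  rewrite Rintegral_cst//= lebesgue_measure_itv/= lte_fin.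
  case: ifPn => [qs'|]; first by rewrite ger0_norm ?subr_ge0.
  by rewrite -leNgt => sq'; rewrite (@le_anti _ _ q s) ?qs ?sq'// subrr normr0.
apply: le_Rintegral => //.
- exact: integrable_norm.
- have cM : mu.-integrable `[q, s] (EFin \o cst M).
    by apply: integrable_itvcc; split => // K; exists `|M|.
  by apply: integrableS cM => //; exact: subset_itv_oc_cc.
- move=> t /=; rewrite in_itv/= => /andP[qt ts]; apply: fM.
  rewrite ger0_norm; last by apply: le_trans (ltW qt).
  by apply: le_trans ts _; apply: le_trans sN; rewrite ler_norm.
Qed.

Lemma continuous_primitive f : locally_bounded_measurable f ->
  continuous (primitive f).
Proof.
move=> lf t; have [_ /(_ (`|t| + 1))[M fM]] := lf.
have M0 : 0 <= M.
  by apply: le_trans (fM 0 _); rewrite ?normr0// addr_ge0.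
apply/cvgrPdist_le => e e0; near=> s.
have st : `|t - s| <= 1 by near: s; apply: cvgr_dist_le.
apply: le_trans (@primitive_lipschitz f (`|t| + 1) M s t lf fM _ _) _.
- have -> : s = t - (t - s) by lra.
  by apply: le_trans (ler_normB _ _) _; rewrite lerD2l.
- by rewrite lerDl.
apply: (@le_trans _ _ ((M + 1) * `|t - s|)); first by rewrite ler_wpM2r// lerDl.
rewrite mulrC -ler_pdivlMr; last by lra.
near: s; apply: cvgr_dist_le => //; rewrite divr_gt0//; lra.
Unshelve. all: by end_near. Qed.

(** Off by one: [c k] is the value at time 0 of element [k.+1], element 0 being the control
    itself. *)
Fixpoint chain c u k : R -> R :=
  if k is k'.+1 then fun t => c k' + primitive (chain c u k') t else u.

(** Total functions, bounded at every real time, stand for the admissible ones extended by zero;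
    this makes most of the analysis independent of [T]. *)
Definition control u := measurable_fun setT u /\ forall t, `|u t| <= 1.

Lemma chain_bound c k (N : R) : exists M : R, forall u, control u ->
  measurable_fun setT (chain c u k) /\
  forall s, `|s| <= N -> `|chain c u k s| <= M.
Proof.
elim: k N => [|k IH] N.
  by exists 1 => u [mu u1]; split => // s _; exact: u1.
have [M HM] := IH N; exists (`|c k| + `|M| * `|N|) => u cu.
have lk : locally_bounded_measurable (chain c u k).
  split; first by have [] := HM _ cu.
  by move=> K; have [M' /(_ _ cu)[_ ?]] := IH K; exists M'.
have [_ {}HM] := HM _ cu.
split.
  apply: measurable_funD => //; apply: continuous_measurable_fun.
  exact: continuous_primitive.
move=> s sN /=; apply: le_trans (ler_normD _ _) _; rewrite lerD2l.
have N0 : 0 <= N by apply: le_trans sN.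
rewrite -[primitive _ _]subr0 -(@primitive_le0 (chain c u k) 0 (lexx 0)).
apply: le_trans (primitive_lipschitz lk HM _ sN) _; first by rewrite normr0.
rewrite subr0; apply: (@le_trans _ _ (`|M| * `|s|)).
  by rewrite ler_wpM2r// ler_norm.
by rewrite ler_wpM2l// (le_trans sN)// ler_norm.
Qed.

Lemma locally_bounded_chain c u k : control u ->
  locally_bounded_measurable (chain c u k).
Proof.
move=> cu; split; first by have [M /(_ _ cu)[]] := chain_bound c k 0.
by move=> N; have [M /(_ _ cu)[_ ?]] := chain_bound c k N; exists M.
Qed.

Lemma continuous_chainS c u k : control u -> continuous (chain c u k.+1).
Proof.
move=> cu t; apply: cvgD; first exact: cvg_cst.
exact: continuous_primitive (locally_bounded_chain c k cu) t.
Qed.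

Lemma chain_linear c d u v (a b : R) k t : control u -> control v ->
  chain (fun k => a * c k + b * d k) (fun t => a * u t + b * v t) k t =
  a * chain c u k t + b * chain d v k t.
Proof.
move=> cu cv; elim: k t => [//|k IH] t /=.
have iu := integrable_itvcc 0 t (locally_bounded_chain c k cu).
have iv := integrable_itvcc 0 t (locally_bounded_chain d k cv).
have h (e : R) g : mu.-integrable `[0, t] (EFin \o g) ->
    mu.-integrable `[0, t] (EFin \o (fun x => e * g x)).
  move=> ig; have -> : EFin \o (fun x => e * g x) = (fun x => e%:E * (EFin \o g) x)%E by apply/funext.
  exact: integrableZl.
rewrite {1}/primitive; under eq_Rintegral => s _ do rewrite IH.
rewrite RintegralD ?RintegralZl//; try exact: h.
rewrite /primitive; ring.
Qed.

Lemma primitive_cvg (f_ : nat -> R -> R) f (t M : R) :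
  (forall m, locally_bounded_measurable (f_ m)) -> locally_bounded_measurable f ->
  (forall m s, `|s| <= `|t| -> `|f_ m s| <= M) ->
  {ae mu, forall s, f_ m s @[m --> \oo] --> f s} ->
  primitive (f_ m) t @[m --> \oo] --> primitive f t.
Proof.
move=> lf_ lf fM ff.
have iM : mu.-integrable `[0, t] (EFin \o cst M).
  by apply: integrable_itvcc; split => // K; exists `|M|.
have m0t : measurable (`[0, t]%classic : set R) by [].
have [| | | | |_ _ h] := @dominated_convergence _ _ _ mu `[0, t]%classic m0t
    (fun m s => (f_ m s)%:E) (EFin \o f) (EFin \o cst M).
- by move=> m; apply/measurable_EFinP/measurable_funTS; case: (lf_ m).
- by apply/measurable_EFinP/measurable_funTS; case: lf.
- apply: filterS ff; first exact: (ae_filter_ringOfSetsType mu).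
  by move=> s fs _; apply: cvg_EFin => //; exact: nearW.
- exact: iM.
- apply: aeW => s m /=; rewrite in_itv/= => /andP[s0 st].
  by rewrite lee_fin fM// !ger0_norm// (le_trans s0).
rewrite /primitive.
have fin : (\int[mu]_(s in `[0%R, t]) (f s)%:E)%E \is a fin_num.
  by apply: integrable_fin_num => //; exact: integrable_itvcc.
by apply: fine_cvg; rewrite fineK.
Qed.

(** One integration turns almost everywhere convergence into convergence at every time, by dominated
    convergence on [[0, t]]; hence the index [k.+1]. *)
Lemma chain_cvg c (u_ : nat -> R -> R) u k :
  (forall m, control (u_ m)) -> control u ->
  {ae mu, forall t, u_ m t @[m --> \oo] --> u t} ->
  forall t, chain c (u_ m) k.+1 t @[m --> \oo] --> chain c u k.+1 t.
Proof.
move=> cu_ cu uu.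
have step j : {ae mu, forall t, chain c (u_ m) j t @[m --> \oo] --> chain c u j t} ->
    forall t, chain c (u_ m) j.+1 t @[m --> \oo] --> chain c u j.+1 t.
  move=> ih t; apply: cvgD; first exact: cvg_cst.
  have [M HM] := chain_bound c j `|t|.
  apply: (@primitive_cvg _ _ _ M) => //.
  - by move=> m; exact: locally_bounded_chain.
  - exact: locally_bounded_chain.
  - by move=> m s st; have [_ ->] := HM _ (cu_ m).
by elim: k => [|k IH]; apply: step => //; exact: aeW.
Qed.
End Chain.

(** * Almost everywhere limits of controls in nested convex sets *)

Section NestedControls.
Context {R : realType}.
Local Notation mu := (@lebesgue_measure R).
Implicit Types (g u v : R -> R).

(** The Gaussian density is positive everywhere and has mass 1, so that as a weight it makes bounded
    functions integrable on the whole line. *)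
Let w : R -> R := normal_pdf 0 1.

Let w_gt0 t : 0 < w t.
Proof.
by rewrite /w normal_pdfE ?oner_neq0// mulr_gt0 ?normal_peak_gt0 ?expR_gt0 ?oner_neq0.
Qed.

Let integrable_weighted g (K : R) : measurable_fun setT g ->
  (forall t, `|g t| <= K) -> mu.-integrable setT (EFin \o (fun t => w t * g t)).
Proof.
move=> mg gK.
have -> : EFin \o (fun t => w t * g t) = ((EFin \o w) \* (EFin \o g))%E.
  by apply/funext => t /=; rewrite EFinM.
apply: integrableMl => //; first exact: integrable_normal_pdf.
by exists K; split; [exact: num_real|move=> x Kx t _; exact: le_trans (gK t) (ltW Kx)].
Qed.

Let phi g := \int[mu]_t (w t * g t).

Let phiD g1 g2 (K1 K2 a b : R) : 
  measurable_fun setT g1 -> (forall t, `|g1 t| <= K1) ->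
  measurable_fun setT g2 -> (forall t, `|g2 t| <= K2) ->
  phi (fun t => a * g1 t + b * g2 t) = a * phi g1 + b * phi g2.
Proof.
move=> m1 K1P m2 K2P.
have h c g K : measurable_fun setT g -> (forall t, `|g t| <= K) ->
    mu.-integrable setT (EFin \o (fun t => c * (w t * g t))).
  move=> mg gK; have -> : EFin \o (fun t => c * (w t * g t)) =
      EFin \o (fun t => w t * (c * g t)).
    by apply/funext => t /=; rewrite mulrCA.
  apply: (@integrable_weighted _ (`|c| * K)); first exact: measurable_funM.
  by move=> t; rewrite normrM ler_wpM2l.
rewrite /phi.
under eq_Rintegral do rewrite mulrDr mulrCA (mulrCA (w _) b).
rewrite RintegralD//; [|exact: h K1P|exact: h K2P].
by rewrite !RintegralZl//; exact: integrable_weighted.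
Qed.

Let le_phi g1 g2 (K1 K2 : R) :
  measurable_fun setT g1 -> (forall t, `|g1 t| <= K1) ->
  measurable_fun setT g2 -> (forall t, `|g2 t| <= K2) ->
  (forall t, g1 t <= g2 t) -> phi g1 <= phi g2.
Proof.
move=> m1 K1P m2 K2P g12; apply: le_Rintegral => //.
- exact: integrable_weighted K1P.
- exact: integrable_weighted K2P.
- by move=> t _; rewrite ler_wpM2l// ltW.
Qed.

Let phi1 : phi (cst 1) = 1.
Proof.
rewrite /phi /Rintegral; under eq_integral do rewrite mulr1.
by rewrite integral_normal_pdf.
Qed.


(** Termwise integration shows that the series of weighted increments has a finite integral, hence
    is finite almost everywhere; dividing by the positive weight gives absolute convergence of the
    telescoping series. *)
Let ae_is_cvg_summable (v_ : nat -> R -> R) (C : R) :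
  (forall m, control (v_ m)) -> 0 <= C ->
  (forall m, phi (fun t => `|v_ m.+1 t - v_ m t|) <= C / (2 ^ m.+1)%:R) ->
  {ae mu, forall t, cvgn (v_ ^~ t)}.
Proof.
move=> cv C0 Cphi.
have md m : measurable_fun setT (fun t => `|v_ m.+1 t - v_ m t|).
  by apply: measurableT_comp => //; apply: measurable_funB; case: (cv m); case: (cv m.+1).
have d2 m t : `| `|v_ m.+1 t - v_ m t| | <= 2.
  rewrite normr_id (le_trans (ler_normB _ _))//.
  by have [_ /(_ t)] := cv m; have [_ /(_ t)] := cv m.+1; lra.
pose D m t := (w t * `|v_ m.+1 t - v_ m t|)%:E.
have D0 m t : (0 <= D m t)%E by rewrite lee_fin mulr_ge0// ltW.
have mD m : measurable_fun setT (D m).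
  by have /measurable_int := integrable_weighted (md m) (d2 m).
have iS : mu.-integrable setT (fun t => \sum_(0 <= m <oo) D m t)%E.
  apply/integrableP; split.
    by apply: ge0_emeasurable_sum => [m t _ _|m _]; [exact: D0|exact: mD].
  under eq_integral do rewrite gee0_abs ?nneseries_ge0//.
  rewrite integral_nneseries//.
  apply: (@le_lt_trans _ _ C%:E); last exact: ltry.
  apply: le_trans (epsilon_trick0 xpredT C0); apply: lee_nneseries.
    by move=> m _ _; apply: integral_ge0.
  move=> m _; rewrite -[leLHS]fineK; first by rewrite lee_fin Cphi.
  by apply: integrable_fin_num => //; exact: integrable_weighted (md m) (d2 m).
have fin := integrable_ae measurableT iS.
apply: filterS fin => t /(_ Logic.I) fint.
have : cvgn (series (telescope (v_ ^~ t))).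
  apply: normed_cvg; apply: nondecreasing_is_cvgn.
    by apply/nondecreasing_seqP => n; rewrite /= !seriesEnat/= big_nat_recr//= lerDl.
  exists ((w t)^-1 * fine (\sum_(0 <= m <oo) D m t)%E) => _ [n _ <-].
  rewrite ler_pdivlMl//= seriesEnat/= mulr_sumr -lee_fin fineK// -sumEFin.
  by apply: (@nneseries_lim_ge R (fun m => D m t) xpredT 0%N n).
move=> cs; have -> : v_ ^~ t = cst (v_ 0%N t) \+ series (telescope (v_ ^~ t)).
  by apply/funext => n; exact: eq_sum_telescope.
by apply: is_cvgD => //; exact: is_cvg_cst.
Qed.

Lemma ae_limit_nested_convex (C : nat -> set (R -> R)) :
  (forall m, C m !=set0) -> (forall m u, C m u -> control u) ->
  (forall m k, (m <= k)%N -> C k `<=` C m) ->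
  (forall m u v, C m u -> C m v -> C m (fun t => 2^-1 * u t + 2^-1 * v t)) ->
  exists v_ : nat -> R -> R, exists v, [/\ forall m, C m (v_ m), control v &
    {ae mu, forall t, v_ m t @[m --> \oo] --> v t}].
Proof.
move=> C0 Cc Cdec Cmid.
have sq_control u : control u ->
    measurable_fun setT (fun t => u t ^+ 2) /\ forall t, `|u t ^+ 2| <= 1.
  move=> [m1 u1]; split; first exact: measurable_funX.
  by move=> t; rewrite normrX exprn_ile1.
pose q u := phi (fun t => u t ^+ 2).
have q_ge0 u : 0 <= q u.
  by apply: Rintegral_ge0 => t _; rewrite mulr_ge0 ?sqr_ge0// ltW.
have q_le1 u : control u -> q u <= 1.
  move=> cu; rewrite -phi1; have [m2 u2] := sq_control _ cu.
  apply: (@le_phi _ _ 1 1) => //; first by move=> t; rewrite normr1.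
  by move=> t; apply: le_trans (u2 t); rewrite ler_norm.
(* The supremum [D] of this set is the limit of the infima of [q] over the sets [C m], which grow
   with [m] because the sets shrink. *)
pose E := [set x | exists m, forall u, C m u -> x <= q u].
have supE : has_sup E.
  split; first by exists 0; exists 0%N => u _; exact: q_ge0.
  exists 1 => x [m xm]; have [u Cu] := C0 m.
  by apply: le_trans (xm _ Cu) (q_le1 _ (Cc _ _ Cu)).
pose D := sup E.
pose a m : R := 1 / (2 ^ m.+1)%:R.
have a0 m : 0 < a m by rewrite divr_gt0// ltr0n expn_gt0.
have aS m : a m.+1 <= a m.
  by rewrite /a !mul1r lef_pV2 ?posrE ?ltr0n ?expn_gt0// ler_nat leq_exp2l.
(* Each control is chosen with the index of a set so deep that [q] exceeds [D - a m ^+ 2] on all of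
   it. If no element had [q] below [D + a m ^+ 2], that number would lie in [E] and exceed its
   supremum. *)
have /choice[p Hp] : forall m, exists p : (R -> R) * nat, [/\ (m <= p.2)%N,
    C p.2 p.1, q p.1 < D + a m ^+ 2 & forall u, C p.2 u -> D - a m ^+ 2 < q u].
  move=> m.
  have a2 : 0 < a m ^+ 2 by rewrite exprn_gt0.
  have [x [N xN] Dx] := sup_adherent a2 supE.
  have [h|/existsNP[u /not_implyP[Cu /negP]]] :=
    EM (forall u, C (maxn m N) u -> D + a m ^+ 2 <= q u); last first.
    rewrite -ltNge => qu; exists (u, maxn m N); split => //=.
      exact: leq_maxl.
    move=> u' /(Cdec _ _ (leq_maxr m N)) Cu'.
    exact: lt_le_trans Dx (xN _ Cu').
  have : D + a m ^+ 2 <= D by apply: ub_le_sup; [case: supE|exists (maxn m N)].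
  by move=> ?; exfalso; lra.
pose v_ m := (p m).1.
have Cv m : C m (v_ m) by have [mN Cp _ _] := Hp m; exact: (Cdec _ _ mN).
have cv m : control (v_ m) by exact: (Cc m).
(* The midpoint [z] lies in the larger of the two sets, so [q z] is at least [D - a m ^+ 2]. In the
   parallelogram identity the multiples of [D] cancel, leaving 2 + 2 + 4 times [a m ^+ 2]. *)
have close m : q (fun t => v_ m.+1 t - v_ m t) <= 8 * a m ^+ 2.
  have [_ Cm qm lm] := Hp m; have [_ CSm qSm lSm] := Hp m.+1.
  pose z t := 2^-1 * v_ m t + 2^-1 * v_ m.+1 t.
  have Sa2 : a m.+1 ^+ 2 <= a m ^+ 2 by rewrite lerXn2r// nnegrE ltW.
  have [cz qz] : control z /\ D - a m ^+ 2 <= q z.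
    have [mm|mm] := leqP (p m).2 (p m.+1).2.
      have Cz := Cmid _ _ _ Cm (Cdec _ _ mm _ CSm).
      by split; [exact: Cc Cz|exact: ltW (lm _ Cz)].
    have Cz := Cmid _ _ _ (Cdec _ _ (ltnW mm) _ Cm) CSm.
    by split; [exact: Cc Cz|have := lSm _ Cz; rewrite -/(z) => ?; lra].
  have [mz z1] := sq_control _ cz.
  have [m0 u0] := sq_control _ (cv m).
  have [m1 u1] := sq_control _ (cv m.+1).
  have -> : q (fun t => v_ m.+1 t - v_ m t) =
      2 * q (v_ m) + 2 * q (v_ m.+1) - 4 * q z.
    pose g t := 2 * v_ m t ^+ 2 + 2 * v_ m.+1 t ^+ 2.
    have mg : measurable_fun setT g by apply: measurable_funD; exact: measurable_funM.
    have g4 t : `|g t| <= 4.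
      rewrite /g (le_trans (ler_normD _ _))// !(normrM 2) !(@ger0_norm _ 2)//.
      by have := u0 t; have := u1 t; lra.
    have -> : q (fun t => v_ m.+1 t - v_ m t) = phi (fun t => 1 * g t + (-4) * z t ^+ 2).
      by congr (phi _); apply/funext => t; rewrite /g /z; field.
    rewrite (@phiD _ _ 4 1)// /g (@phiD _ _ 1 1)// /q; ring.
  by rewrite /v_; lra.
have phi_le m : phi (fun t => `|v_ m.+1 t - v_ m t|) <= 5 / (2 ^ m.+1)%:R.
  pose d t := v_ m.+1 t - v_ m t.
  have md : measurable_fun setT d by apply: measurable_funB; case: (cv m); case: (cv m.+1).
  have d2 t : `|d t| <= 2.
    rewrite (le_trans (ler_normB _ _))//.
    by have [_ /(_ t)] := cv m; have [_ /(_ t)] := cv m.+1; lra.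
  have dd4 t : `|d t ^+ 2| <= 4.
    by rewrite normrX (_ : 4 = 2 ^+ 2) ?lerXn2r ?nnegrE//; ring.
  have md2 : measurable_fun setT (fun t => d t ^+ 2) by exact: measurable_funX.
  have mnd : measurable_fun setT (fun t => `|d t|) by apply: measurableT_comp.
  have A0 : 0 <= a m / 2 by rewrite divr_ge0// ltW.
  have B0 : 0 <= (2 * a m)^-1 by rewrite invr_ge0 mulr_ge0// ltW.
  (* Young's inequality [|d| <= a / 2 + d ^+ 2 / (2 * a)] passes from the square norm to the L^1
     norm. The constant 8, relaxed to 9, yields [5 * a m]. *)
  pose g t := a m / 2 * 1 + (2 * a m)^-1 * d t ^+ 2.
  apply: (@le_trans _ _ (phi g)).
    apply: (@le_phi _ _ 2 (a m / 2 + (2 * a m)^-1 * 4)).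
    - exact: mnd.
    - by move=> t; rewrite normr_id; exact: d2.
    - by apply: measurable_funD => //; exact: measurable_funM.
    - move=> t; rewrite /g mulr1 (le_trans (ler_normD _ _))//.
      rewrite (ger0_norm A0) (normrM (2 * a m)^-1) (ger0_norm B0).
      by rewrite lerD2l ler_wpM2l// dd4.
    - move=> t; have := sqr_ge0 (`|d t| - a m).
      rewrite /g -[d t ^+ 2]real_normK ?num_real//; move: `|d t| => x h.
      have -> : a m / 2 * 1 + (2 * a m)^-1 * x ^+ 2 =
          x + (2 * a m)^-1 * (x - a m) ^+ 2 by field; exact: lt0r_neq0.
      by rewrite lerDl mulr_ge0// sqr_ge0.
  rewrite /g (@phiD (cst 1) _ 1 4) => //; last by move=> t; rewrite normr1.
  rewrite phi1 mulr1.
  have -> : 5 / (2 ^ m.+1)%:R = a m / 2 + (2 * a m)^-1 * (9 * a m ^+ 2).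
    rewrite (_ : 5 / _ = 5 * a m); last by rewrite /a mul1r.
    by field; exact: lt0r_neq0.
  rewrite lerD2l ler_wpM2l//.
  by have := close m; have := sqr_ge0 (a m); rewrite /q -/d; lra.
have := @ae_is_cvg_summable v_ 5 cv (ltW _) phi_le.
move=> /(_ ltac:(by []))aec.
(* The truncated upper limit is measurable with values in [-1, 1] even where the sequence
   diverges. *)
pose v t := Num.max (-1) (Num.min 1 (limn_sup (v_ ^~ t))).
exists v_, v; split => //.
  split.
    apply: measurable_maxr => //; apply: measurable_minr => //.
    apply: measurable_fun_limn_sup => //.
    - by move=> t _; exists 1 => _ [m _ <-]; have [_ /(_ t)] := cv m; rewrite ler_norml => /andP[].
    - by move=> t _; exists (-1) => _ [m _ <-]; have [_ /(_ t)] := cv m; rewrite ler_norml => /andP[].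
    - by move=> m; case: (cv m).
  by move=> t; rewrite ler_norml /v le_max lexx/= ge_max ge_min lexx/= andbT; lra.
apply: filterS aec; first exact: (ae_filter_ringOfSetsType mu).
move=> t ct; rewrite /v cvg_limn_supE//.
have l1 : limn (v_ ^~ t) <= 1.
  apply: limr_le => //; apply: nearW => m.
  by have [_ /(_ t)] := cv m; rewrite ler_norml => /andP[].
have lN1 : -1 <= limn (v_ ^~ t).
  apply: limr_ge => //; apply: nearW => m.
  by have [_ /(_ t)] := cv m; rewrite ler_norml => /andP[].
rewrite (min_idPr l1) (max_idPr lN1); exact: ct.
Qed.

End NestedControls.

(** * Steering the chain to the origin in finite time *)

Section NullControl.
Context {R : realType}.
Local Notation mu := (@lebesgue_measure R).
Implicit Types (p q : {poly R}).

Lemma horner_derivn_mul_expXsubC q (a : R) m j : (j < m)%N ->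
  ((q * ('X - a%:P) ^+ m)^`(j)).[a] = 0.
Proof.
elim: j m q => [|j IH] [//|m] q jm; first by rewrite derivn0 hornerM horner_exp hornerXsubC subrr expr0n mulr0.
rewrite derivSn derivM deriv_exp derivXsubC mul1r /=.
have -> : q^`() * ('X - a%:P) ^+ m.+1 + q * (('X - a%:P) ^+ m *+ m.+1) =
    (q^`() * ('X - a%:P) + q *+ m.+1) * ('X - a%:P) ^+ m.
  by rewrite mulrDl exprS mulrA mulrnAr mulrnAl.
exact: IH.
Qed.

(** By Bezout, some multiple of [('X - 1%:P) ^+ n] is congruent to 1 modulo ['X^n]. Its product with
    ['X^i] divided by the factorial of [i] agrees with that monomial to order [n] at 0 and vanishes
    to order [n] at 1. *)
Lemma hermite_basis n i : (i < n)%N -> exists h : {poly R}, forall j, (j < n)%N ->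
  (h^`(j)).[0] = (j == i)%:R /\ (h^`(j)).[1] = 0.
Proof.
move=> ni.
have cop : coprimep ('X^n : {poly R}) (('X - 1%:P) ^+ n).
  apply: coprimep_expl; apply: coprimep_expr.
  by have := @coprimep_XsubC2 R 0 1; rewrite !subr0; apply; exact: oner_neq0.
have [g [v vE]] : exists g v : {poly R}, v * ('X - 1%:P) ^+ n = 1 - g * 'X^n.
  have /Bezout_coprimepP[[g v] /= /eqpP[[c1 c2] /= /andP[c1n0 c2n0] e]] := cop.
  exists ((c1 / c2) *: g), ((c1 / c2) *: v).
  have {}e : (c1 / c2) *: (g * 'X^n + v * ('X - 1%:P) ^+ n) = 1.
    by rewrite mulrC -scalerA e scalerA mulVf// scale1r.
  by rewrite -e scalerDr -!scalerAl [RHS]addrC addKr.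
exists (((i`!%:R)^-1 *: 'X^i) * (v * ('X - 1%:P) ^+ n)) => j nj; split; last first.
  by rewrite mulrA horner_derivn_mul_expXsubC.
rewrite vE horner_coef0 coef_derivn addn0 ffactnn mulrBr mulr1 mulrA coefB coefMXn nj subr0.
rewrite coefZ coefXn; case: eqP => [->|_]; last by rewrite mulr0 mul0rn.
by rewrite ?mulr1n mulr1 -[LHS]mulr_natr mulVf// pnatr_eq0 -lt0n fact_gt0.
Qed.

Lemma integral_deriv_poly p (t : R) : 0 <= t ->
  \int[mu]_(s in `[0, t]) (p^`()).[s] = p.[t] - p.[0].
Proof.
rewrite le_eqVlt => /predU1P[<-|t0]; first by rewrite set_itv1 Rintegral_set1 subrr.
rewrite /Rintegral (@continuous_FTC2 _ _ (horner p))//.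
- by apply: continuous_subspaceT; exact: continuous_horner.
- split.
  + by move=> x _; have [] := is_derive_poly p x.
  + by apply: cvg_at_right_filter; exact: continuous_horner.
  + by apply: cvg_at_left_filter; exact: continuous_horner.
- by move=> x _; rewrite derive1E; have [_ ->] := is_derive_poly p x.
Qed.

Lemma derivn_comp_scaleX p (a : R) j :
  (p \Po (a *: 'X))^`(j) = a ^+ j *: (p^`(j) \Po (a *: 'X)).
Proof.
elim: j => [|j IH]; first by rewrite expr0 scale1r.
rewrite derivnS IH derivZ deriv_comp derivZ derivX -derivnS.
by rewrite alg_polyC mulrC mul_polyC scalerA -exprSr.
Qed.

Lemma horner_bound01 p : exists M, 0 <= M /\ forall s, 0 <= s <= 1 -> `|p.[s]| <= M.
Proof.
have [|x _ Mx] := @EVT_max R (fun s => `|p.[s]|) 0 1 ler01.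
  apply: continuous_subspaceT => s; apply: continuous_comp; first exact: continuous_horner.
  exact: norm_continuous.
by exists `|p.[x]|; split => // s s01; apply: Mx; rewrite in_itv.
Qed.

(* Slowing down a transfer on [0, 1] by a factor S makes its n-th derivative
   O(1/S). *)
Lemma transfer_poly n (b : nat -> R) : exists (S : R) p, [/\ 0 <= S,
  forall j, (j < n)%N -> (p^`(j)).[0] = b j /\ (p^`(j)).[S] = 0 &
  forall s, 0 <= s <= S -> `|(p^`(n)).[s]| <= 1].
Proof.
have /choice[h hP] : forall i, exists h : {poly R}, (i < n)%N ->
    forall j, (j < n)%N -> (h^`(j)).[0] = (j == i)%:R /\ (h^`(j)).[1] = 0.
  move=> i; have [ni|ni] := boolP (i < n)%N; last by exists 0.
  by have [h hP] := hermite_basis ni; exists h.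
have /choice[M MP] := fun i => horner_bound01 ((h i)^`(n)).
pose B := \sum_(i < n) `|b i| * M i.
have B0 : 0 <= B by apply: sumr_ge0 => i _; rewrite mulr_ge0//; case: (MP i).
(* As [S >= 1], the factor [S ^+ i / S ^+ n] is at most [1 / S] for [i < n], which bounds the [n]-th
   derivative by [B / S <= 1]. The factor [S ^+ i] in [p] undoes the effect of the rescaling on the
   [i]-th derivative at 0. *)
pose S := 1 + B.
have S1 : 1 <= S by rewrite lerDl.
have S0 : 0 < S by apply: lt_le_trans S1.
pose p : {poly R} := \sum_(i < n) (b i * S ^+ i) *: (h i \Po (S^-1 *: 'X)).
have pE j s : (p^`(j)).[s] = \sum_(i < n) b i * S ^+ i * S^-1 ^+ j * ((h i)^`(j)).[s / S].
  rewrite /p raddf_sum horner_sum; apply: eq_bigr => i _.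
  rewrite /= derivnZ derivn_comp_scaleX scalerA hornerZ horner_comp hornerZ hornerX.
  by rewrite (mulrC s).
exists S, p; split; first exact: ltW.
- move=> j nj; rewrite !pE; split.
    rewrite (bigD1 (Ordinal nj))//= big1 => [|i ij].
      rewrite mul0r; have [-> _] := hP _ nj _ nj.
      by rewrite eqxx addr0 mulr1 exprVn mulfK// expf_neq0// gt_eqF.
    rewrite mul0r; have [-> _] := hP _ (ltn_ord i) _ nj.
    by move: ij; rewrite -val_eqE/= eq_sym => /negbTE ->; rewrite mulr0.
  apply: big1 => i _; rewrite divff ?gt_eqF//.
  by have [_ ->] := hP _ (ltn_ord i) _ nj; rewrite mulr0.
- move=> s /andP[s0 sS]; rewrite pE.
  apply: le_trans (ler_norm_sum _ _ _) _.
  apply: (@le_trans _ _ (\sum_(i < n) S^-1 * (`|b i| * M i))).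
    apply: ler_sum => i _; rewrite -!mulrA normrM [leRHS]mulrCA ler_wpM2l//.
    rewrite mulrA normrM ler_pM//.
      rewrite ger0_norm; last by rewrite mulr_ge0// exprn_ge0// ?invr_ge0 ltW.
      rewrite exprVn ler_pdivrMr ?exprn_gt0// mulrC ler_pdivlMr//.
      by rewrite -exprSr ler_weXn2l.
    have [_ ->//] := MP i.
    by rewrite divr_ge0 ?(ltW S0)//= ler_pdivrMr// mul1r.
  by rewrite -mulr_sumr ler_pdivrMl// mulr1 /S -/B lerDr.
Qed.

(** The control is the [n]-th derivative of a transfer polynomial on [[0, S]] and zero afterwards.
    Element [k] of the chain is then the derivative of order [n - k], whence the reversed indexing
    of the initial data. *)
Lemma null_control (c : nat -> R) n : exists u (S : R), control u /\
  forall k t, (0 < k <= n)%N -> S <= t -> chain c u k t = 0.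
Proof.
have [S [p [S0 p0 pn]]] := transfer_poly n (fun j => c (n - j.+1)%N).
pose u := (fun t => (p^`(n)).[t]) \_ `[0, S].
have cu : control u.
  split.
    apply/(measurable_restrictT _ _).1 => //.
    by apply: measurable_funTS; apply: continuous_measurable_fun; exact: continuous_horner.
  by move=> t; rewrite /u patchE; case: ifPn => [|_]; [rewrite inE/= in_itv => /pn|rewrite normr0].
(* The second clause concerns times strictly after [S], since the control, at [k = 0], need not
   vanish at [S] itself. *)
have H k : (k <= n)%N -> (forall t, 0 <= t <= S -> chain c u k t = (p^`(n - k)).[t]) /\
    (forall t, S < t -> chain c u k t = 0).
  elim: k => [_|k IH kn].
    split=> t /=.
      by move=> t0S; rewrite subn0 /u patchE mem_set//= in_itv.
    move=> St; rewrite /u patchE; case: ifPn => //; rewrite inE/= in_itv/= => /andP[_].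
    by rewrite leNgt St.
  have [IHin IHout] := IH (ltnW kn).
  have [pk0 pkS] := p0 (n - k.+1)%N (ltac:(by rewrite ltn_subrL (leq_trans _ kn))).
  have inS t : 0 <= t <= S -> chain c u k.+1 t = (p^`(n - k.+1)).[t].
    move=> /andP[t0 tS] /=; rewrite /primitive.
    under eq_Rintegral => s.
      rewrite inE/= in_itv/= => /andP[s0 st].
      rewrite IHin; last by rewrite s0 (le_trans st).
      rewrite -[(n - k)%N]prednK ?subn_gt0// derivnS -subnS.
      over.
    rewrite integral_deriv_poly// pk0 subnSK// subKn; last exact: ltnW.
    by rewrite addrC subrK.
  split=> // t St.
  have : chain c u k.+1 t - chain c u k.+1 S = 0.
    rewrite /= opprD addrACA subrr add0r /primitive Rintegral_itvB ?bnd_simp ?(ltW St)//.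
      under eq_Rintegral => s.
        by rewrite inE/= in_itv/= => /andP[? _]; rewrite IHout//; over.
      by rewrite Rintegral_cst// mul0r.
    exact: integrable_itvcc (locally_bounded_chain c k cu).
  by rewrite (inS S) ?lexx ?S0// pkS subr0.
exists u, S; split=> // k t /andP[k0 kn]; rewrite le_eqVlt => /predU1P[<-|]; last by case: (H _ kn) => _; apply.
have [-> //] := H _ kn; last by rewrite lexx S0.
by have [] := p0 (n - k)%N (ltac:(by rewrite ltn_subrL k0 (leq_trans k0 kn))).
Qed.
End NullControl.

(** * The horizon and the extension of controls by zero *)

Section Horizon.
Context {R : realType}.
Implicit Types (T : \bar R).

Lemma measurable_horizon T : measurable (horizon T).
Proof.
apply: is_interval_measurable => x y [x0 xT] [y0 yT] z /andP[xz zy].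
by split; [exact: le_trans xz|apply: le_lt_trans yT; rewrite lee_fin].
Qed.

Lemma horizon_itv T t : horizon T t -> `[0, t] `<=` horizon T.
Proof.
move=> [t0 tT] s /=; rewrite in_itv/= => /andP[s0 st].
by split => //; apply: le_lt_trans tT; rewrite lee_fin.
Qed.

Lemma horizon0 T : (0 < T)%E -> horizon T 0.
Proof. by move=> T0; split. Qed.

Lemma admissible_control T u : control u -> admissible T u.
Proof.
move=> [mu u1]; split; first exact: measurable_funTS.
by move=> t _; rewrite -ler_norml.
Qed.

Lemma control_restrict T u : admissible T u -> control (u \_ (horizon T)).
Proof.
move=> [mu u1]; split.
  by apply/(measurable_restrictT _ _).1 => //; exact: measurable_horizon.
move=> t; rewrite patchE; case: ifPn => [|_]; last by rewrite normr0.
by rewrite inE => /u1; rewrite ler_norml.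
Qed.
End Horizon.

Lemma cvg_mx {R : realType} {m n} {I : Type} (G : set_system I) {FG : Filter G}
    (f : I -> 'M[R]_(m, n)) (l : 'M[R]_(m, n)) :
  (forall i j, f x i j @[x --> G] --> l i j) -> f x @[x --> G] --> l.
Proof.
move=> fl A [P lP sPA].
have GP : \forall x \near G, forall i j, P i j (f x i j).
  by apply: filter_forall => i; apply: filter_forall => j; exact: fl (lP i j).
by apply: filterS GP => x Px; exact: sPA.
Qed.

(** * Explicit form of the trajectories *)

Section State.
Context {R : realType} {n : nat}.
Local Notation mu := (@lebesgue_measure R).
Implicit Types (x y : 'cV[R]_n) (u v : R -> R) (T : \bar R).

(** Extension by 0 to all natural indices lets coordinates be shifted and fed to [chain] without
    ordinals. *)
Definition entry x (j : nat) : R := if insub j is Some i then x i 0 else 0.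

Lemma entry_ord x (i : 'I_n) : entry x i = x i 0.
Proof. by rewrite /entry valK. Qed.

Lemma dynamicsE x w (i : 'I_n) :
  dynamics x w i 0 = if i.+1 == n then w else entry x i.+1.
Proof.
rewrite /dynamics !mxE; under eq_bigr do rewrite mxE.
rewrite /entry; case: insubP => [j _ ji|]; last first.
  rewrite -leqNgt => ni; have -> : i.+1 == n by rewrite eqn_leq ltn_ord ni.
  rewrite mulr1 big1 ?add0r// => j _; case: eqP => [e|]; last by rewrite mul0r.
  by have := ltn_ord j; rewrite e ltnNge ni.
rewrite (bigD1 j)//= ji eqxx mul1r big1 ?addr0 => [|k kj].
  have -> : (i.+1 == n) = false by apply/negbTE; rewrite -ji neq_ltn ltn_ord.
  by rewrite mulr0 addr0.
by case: eqP => [e|]; rewrite ?mul0r//; case/negP: kj; rewrite -val_eqE/= e ji.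
Qed.

(* [chain] numbers the integrators starting from the control, so that the
   coordinate i : 'I_n of the state is the chain element n - i. *)
Definition state x u t : 'cV[R]_n :=
  \col_i chain (fun k => entry x (n - k.+1)) u (n - i) t.

Lemma continuous_state x u : control u -> continuous (state x u).
Proof.
move=> cu t; apply: cvg_mx => i j; rewrite mxE.
under eq_fun do rewrite mxE.
by rewrite -[(n - i)%N]prednK ?subn_gt0//; exact: continuous_chainS.
Qed.

Lemma state_cvg x (u_ : nat -> R -> R) u :
  (forall m, control (u_ m)) -> control u ->
  {ae mu, forall t, u_ m t @[m --> \oo] --> u t} ->
  forall t, state x (u_ m) t @[m --> \oo] --> state x u t.
Proof.
move=> cu_ cu uu t; apply: cvg_mx => i j; rewrite mxE.
under eq_fun do rewrite mxE.
by rewrite -[(n - i)%N]prednK ?subn_gt0//; exact: chain_cvg.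
Qed.

Lemma state_trajectory T x u v : control v -> {in horizon T, u =1 v} ->
  is_trajectory T x u (state x v).
Proof.
move=> cv uv; split.
  by apply: continuous_subspaceT; exact: continuous_state.
move=> t Tt i; rewrite mxE -[(n - i)%N]prednK ?subn_gt0// -subnS/=.
rewrite subnSK// subKn ?entry_ord; last exact: ltnW.
congr (_ + _); apply: eq_Rintegral => s; rewrite inE => /(horizon_itv Tt) Ts.
rewrite dynamicsE; case: eqP => [->|/eqP ni]; first by rewrite subnn uv ?inE.
have ni' : (i.+1 < n)%N by rewrite ltn_neqAle ni ltn_ord.
by rewrite (entry_ord _ (Ordinal ni')) mxE.
Qed.

Lemma trajectory_unique T x u v z : is_trajectory T x u z ->
  {in horizon T, u =1 v} -> {in horizon T, z =1 state x v}.
Proof.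
move=> [_ zE] uv.
(* The induction climbs from the last coordinate, driven by the control alone; each earlier
   coordinate is determined by the next one. *)
have H k (i : 'I_n) : (n - i)%N = k.+1 -> forall t, horizon T t ->
    z t i 0 = state x v t i 0.
  elim: k i => [|k IH] i nik t Tt; rewrite (zE _ Tt) mxE nik /=.
    have -> : (n - 1)%N = i by apply/eqP; rewrite -(eqn_add2r 1) -nik; lia.
    rewrite entry_ord; congr (_ + _).
    apply: eq_Rintegral => s; rewrite inE => /(horizon_itv Tt) Ts.
    by rewrite dynamicsE ifT ?uv ?inE//; apply/eqP; lia.
  have -> : (n - k.+2)%N = i by lia.
  rewrite entry_ord; congr (_ + _).
  apply: eq_Rintegral => s; rewrite inE => /(horizon_itv Tt) Ts.
  have ni : (i.+1 < n)%N by lia.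
  have nik' : (n - Ordinal ni)%N = k.+1 by rewrite /=; lia.
  rewrite dynamicsE ifF; last by apply/eqP; lia.
  by rewrite (entry_ord _ (Ordinal ni)) (IH _ nik')// mxE nik'.
move=> t; rewrite inE => Tt; apply/matrixP => i j; rewrite ord1.
by apply: (H (n - i).-1); rewrite // prednK// subn_gt0.
Qed.

(** The explicit state shows that the choice made by [trajectory] is an actual solution; uniqueness
    identifies it. *)
Lemma trajectory_state T x u v : control v -> {in horizon T, u =1 v} ->
  {in horizon T, trajectory T x u =1 state x v}.
Proof.
move=> cv uv; apply: trajectory_unique (uv).
by apply: getPex; exists (state x v); exact: state_trajectory.
Qed.

Lemma state_linear x y u v (a b : R) t : control u -> control v ->
  state (a *: x + b *: y) (fun t => a * u t + b * v t) t =
  a *: state x u t + b *: state y v t.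
Proof.
move=> cu cv; apply/matrixP => i j; rewrite !mxE -chain_linear//.
congr (chain _ _ _ _); apply/funext => k; rewrite /entry.
by case: insub => [l|]; rewrite ?mxE// !mulr0 addr0.
Qed.

Lemma state0 x u : state x u 0 = x.
Proof.
apply/matrixP => i j; rewrite ord1 mxE -[(n - i)%N]prednK ?subn_gt0//= -subnS.
by rewrite primitive_le0// addr0 subnSK// subKn ?entry_ord// ltnW.
Qed.

End State.

Lemma convex_functionP {R : realType} {n} (F : 'cV[R]_n -> R) : convex F <->
  forall a b x y, 0 <= a -> 0 <= b -> a + b = 1 ->
    F (a *: x + b *: y) <= a * F x + b * F y.
Proof.
split=> [cF a b x y a0 b0 ab|h t x y _ _]; last first.
  by rewrite convRE; apply: h; rewrite /unstable.onem ?subr_ge0// addrC subrK.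
have a1 : a <= 1 by lra.
have be : b = 1 - a by lra.
have := cF (Itv01 a0 a1) x y (mem_setT _) (mem_setT _).
by rewrite convRE be.
Qed.

Lemma limn_einf_le {R : realType} (u : (\bar R)^nat) (c : \bar R) :
  (forall m, u m <= c)%E -> (limn_einf u <= c)%E.
Proof.
move=> uc; rewrite limn_einf_lim; apply: lime_le; first exact: is_cvg_einfs.
apply: nearW => m; apply: le_trans (uc m).
by apply: ereal_inf_lbound; exists m => /=.
Qed.

(** * Integrals of continuous functions over the horizon *)

Section IntegralHorizon.
Context {R : realType}.
Local Notation mu := (@lebesgue_measure R).
Implicit Types (T : \bar R) (f g d : R -> R).

(** This room to the right turns positivity of a continuous integrand at a single time, even 0, into
    a positive integral. *)
Lemma horizon_right T t : horizon T t -> exists2 s, t < s & horizon T s.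
Proof.
move=> [t0]; case: T => [r| |] //=.
  rewrite lte_fin => tr; exists ((t + r) / 2); first lra.
  by split; rewrite ?lte_fin; lra.
by move=> _; exists (t + 1); [lra|split; [lra|exact: ltry]].
Qed.

Lemma integral_continuous_eq0 T d : continuous d -> (forall t, 0 <= d t) ->
  (\int[mu]_(t in horizon T) (d t)%:E <= 0)%E ->
  forall t, horizon T t -> d t = 0.
Proof.
move=> cd d0 id t Tt; apply/eqP; rewrite eq_le d0 andbT leNgt; apply/negP => dt.
have [s ts Ts] := horizon_right Tt.
have [e /= e0 de] : exists2 e, 0 < e & forall r, `|t - r| < e -> d t / 2 <= d r.
  have /cvgrPdist_lt/(_ (d t / 2)) := cd t.
  rewrite divr_gt0// => /(_ isT) [e /= e0 he]; exists e => // r /he /=.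
  by rewrite ltr_norml => /andP[_ ?]; lra.
pose s' := Num.min s (t + e / 2).
have ts' : t < s' by rewrite lt_min ts/= ltrDl divr_gt0.
have Ts' : `[t, s'] `<=` horizon T.
  move=> r /=; rewrite in_itv/= => /andP[tr rs']; apply: (horizon_itv Ts) => /=.
  rewrite in_itv/= (le_trans _ tr)/=; last by case: Tt.
  by rewrite (le_trans rs')// ge_min lexx.
have md : measurable_fun setT d by exact: continuous_measurable_fun.
suff : (0 < \int[mu]_(t in horizon T) (d t)%:E)%E by rewrite ltNge id.
apply: (@lt_le_trans _ _ (\int[mu]_(r in `[t, s']) (d t / 2)%:E)%E).
  rewrite integral_cst//= lebesgue_measure_itv/= lte_fin ts' -EFinB -EFinM lte_fin.
  by rewrite mulr_gt0 ?subr_gt0// divr_gt0.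
apply: (@le_trans _ _ (\int[mu]_(r in `[t, s']) (d r)%:E)%E).
  apply: ge0_le_integral => //.
  - by move=> r _; rewrite lee_fin divr_ge0.
  - by apply/measurable_EFinP; exact: measurable_funTS.
  move=> r /=; rewrite in_itv/= => /andP[tr rs']; rewrite lee_fin; apply: de.
  rewrite ler0_norm ?subr_le0//.
  have : r <= t + e / 2 by rewrite (le_trans rs')// ge_min lexx orbT.
  lra.
apply: ge0_subset_integral => //.
- exact: measurable_horizon.
- by apply/measurable_EFinP; exact: measurable_funTS.
- by move=> r _; rewrite lee_fin.
Qed.

(** Finiteness of the integral of [f] allows it to be subtracted; the nonnegative continuous
    function [g - f] then has integral at most 0. *)
Lemma continuous_integral_ge T f g : continuous f -> continuous g ->
  (forall t, 0 <= f t <= g t) ->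
  (\int[mu]_(t in horizon T) (g t)%:E <= \int[mu]_(t in horizon T) (f t)%:E)%E ->
  (\int[mu]_(t in horizon T) (f t)%:E < +oo)%E ->
  forall t, horizon T t -> f t = g t.
Proof.
move=> cf cg fg gf foo t Tt.
have f0 s : 0 <= f s by case/andP: (fg s).
have d0 s : 0 <= g s - f s by rewrite subr_ge0; case/andP: (fg s).
have cd : continuous (fun s => g s - f s) by move=> s; apply: cvgB; [exact: cg|exact: cf].
have ffin : (\int[mu]_(t in horizon T) (f t)%:E)%E \is a fin_num.
  by rewrite ge0_fin_numE// integral_ge0// => s _; rewrite lee_fin.
have mE (h : R -> R) : continuous h -> measurable_fun (horizon T) (fun s => (h s)%:E).
  move=> ch; have mh := continuous_measurable_fun ch.
  by apply/measurable_EFinP; exact: measurable_funTS.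
suff id : (\int[mu]_(s in horizon T) (g s - f s)%:E <= 0)%E.
  apply/esym/eqP; rewrite -subr_eq0; apply/eqP.
  exact: (@integral_continuous_eq0 T (fun s => g s - f s)).
rewrite -(leeD2lE _ _ ffin) adde0; apply: le_trans gf.
rewrite -ge0_integralD//; first last.
- exact: mE.
- by move=> s _; rewrite lee_fin.
- exact: mE.
- by move=> s _; rewrite lee_fin.
- exact: measurable_horizon.
by under eq_integral do rewrite -EFinD addrC subrK.
Qed.
End IntegralHorizon.

(** * Finiteness, semicontinuity and convexity of the cost; existence of minimizers *)

Section Cost.
Context {R : realType} {n : nat} (F : 'cV[R]_n -> R) (T : \bar R).
Context (F_cont : continuous F) (F_ge0 : forall x, 0 <= F x) (F0 : F 0 = 0).
Local Notation mu := (@lebesgue_measure R).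
Implicit Types (x y : 'cV[R]_n) (u v : R -> R).

Definition state_cost x u : \bar R :=
  (\int[mu]_(t in horizon T) (F (state x u t))%:E)%E.

Lemma cost_state x u v : control v -> {in horizon T, u =1 v} ->
  cost F T x u = state_cost x v.
Proof.
move=> cv uv; apply: eq_integral => t Tt; congr (F _)%:E.
exact: (trajectory_state _ cv uv).
Qed.

Lemma cost_control x u : control u -> cost F T x u = state_cost x u.
Proof. by move=> cu; exact: cost_state. Qed.

Lemma cost_restrict x u : admissible T u ->
  cost F T x u = state_cost x (u \_ (horizon T)).
Proof.
move=> au; apply: cost_state; first exact: control_restrict.
by move=> t Tt; rewrite patchE Tt.
Qed.

Lemma continuous_F_state x u : control u -> continuous (fun t => F (state x u t)).
Proof.
by move=> cu t; apply: continuous_comp; [exact: continuous_state|exact: F_cont].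
Qed.

Lemma measurable_F_state x u (D : set R) : control u ->
  measurable_fun D (fun t => (F (state x u t))%:E).
Proof.
move=> cu; have mF := continuous_measurable_fun (@continuous_F_state x u cu).
by apply/measurable_EFinP; exact: measurable_funTS.
Qed.

Lemma state_cost_ge0 x u : (0 <= state_cost x u)%E.
Proof. by apply: integral_ge0 => t _; rewrite lee_fin. Qed.

(** Once steered to the origin the state stays there, where [F] vanishes, so only a compact interval
    contributes. *)
Lemma exists_finite_cost x : exists2 u, control u & (state_cost x u < +oo)%E.
Proof.
have [u [S [cu uS]]] := null_control (fun k => entry x (n - k.+1)) n.
exists u => //.
have stS t : S <= t -> state x u t = 0.
  move=> St; apply/matrixP => i j; rewrite !mxE uS//.
  by rewrite subn_gt0 ltn_ord leq_subr.
have -> : state_cost x u =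
    (\int[mu]_(t in horizon T `&` `[0%R, S]) (F (state x u t))%:E)%E.
  rewrite integral_mkcondr; apply: eq_integral => t; rewrite inE => -[t0 _].
  rewrite patchE; case: ifPn => //; rewrite notin_setE/= in_itv/= t0/= => /negP.
  by rewrite -ltNge => /ltW /stS ->; rewrite F0.
apply: (@le_lt_trans _ _ (\int[mu]_(t in `[0%R, S]) (F (state x u t))%:E)%E).
  apply: ge0_subset_integral => //.
  - by apply: measurableI => //; exact: measurable_horizon.
  - exact: measurable_F_state.
  - by move=> t _; rewrite lee_fin.
have iF : mu.-integrable `[0, S] (EFin \o (fun t => F (state x u t))).
  apply: continuous_compact_integrable; first exact: segment_compact.
  by apply: continuous_subspaceT; exact: continuous_F_state.
by rewrite -ge0_fin_numE ?integrable_fin_num// integral_ge0// => t _; rewrite lee_fin.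
Qed.

(** The running costs converge at every time by continuity of [F], so Fatou's lemma applies, on an
    infinite horizon as well. *)
Lemma state_cost_lsc x (u_ : nat -> R -> R) u (c : \bar R) :
  (forall m, control (u_ m)) -> control u ->
  {ae mu, forall t, u_ m t @[m --> \oo] --> u t} ->
  (forall m, state_cost x (u_ m) <= c)%E -> (state_cost x u <= c)%E.
Proof.
move=> cu_ cu uu uc.
pose f m t := (F (state x (u_ m) t))%:E.
have -> : state_cost x u = (\int[mu]_(t in horizon T) limn_einf (f ^~ t))%E.
  apply: eq_integral => t _; apply/esym.
  rewrite (cvg_limn_einf_sup (l := (F (state x u t))%:E) _).1//.
  apply: cvg_EFin; first exact: nearW.
  apply: continuous_cvg; first exact: F_cont.
  exact: state_cvg.
apply: le_trans (fatou mu _ _ _) _.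
- exact: measurable_horizon.
- by move=> m; exact: measurable_F_state.
- by move=> m t _; rewrite lee_fin.
exact: limn_einf_le.
Qed.

Section Convex.
Context (F_convex : forall (a b : R) x y, 0 <= a -> 0 <= b -> a + b = 1 ->
    F (a *: x + b *: y) <= a * F x + b * F y).

Lemma control_convex u v (a b : R) : 0 <= a -> 0 <= b -> a + b = 1 ->
  control u -> control v -> control (fun t => a * u t + b * v t).
Proof.
move=> a0 b0 ab [mu u1] [mv v1]; split.
  by apply: measurable_funD; exact: measurable_funM.
move=> t; rewrite (le_trans (ler_normD _ _))// !normrM (ger0_norm a0) (ger0_norm b0).
by rewrite -ab lerD// ler_piMr.
Qed.

Lemma integral_convex_combination x y u v (a b : R) : 0 <= a -> 0 <= b ->
  control u -> control v ->
  (\int[mu]_(t in horizon T) (a * F (state x u t) + b * F (state y v t))%R%:E =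
   a%:E * state_cost x u + b%:E * state_cost y v)%E.
Proof.
move=> a0 b0 cu cv.
have mH := measurable_horizon T.
rewrite /state_cost -!ge0_integralZl//; try by [exact: measurable_F_state|move=> t _; rewrite lee_fin].
rewrite -ge0_integralD//.
- by move=> t _; rewrite lee_fin mulr_ge0.
- by apply: emeasurable_funM => //; exact: measurable_F_state.
- by move=> t _; rewrite lee_fin mulr_ge0.
- by apply: emeasurable_funM => //; exact: measurable_F_state.
Qed.

Lemma state_cost_convex x y u v (a b : R) : 0 <= a -> 0 <= b -> a + b = 1 ->
  control u -> control v ->
  (state_cost (a *: x + b *: y)%R (fun t => a * u t + b * v t)%R <=
   a%:E * state_cost x u + b%:E * state_cost y v)%E.
Proof.
move=> a0 b0 ab cu cv; rewrite -integral_convex_combination//.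
have cw := control_convex a0 b0 ab cu cv.
apply: ge0_le_integral.
- exact: measurable_horizon.
- by move=> t _; rewrite lee_fin.
- exact: measurable_F_state.
- apply/measurable_EFinP; apply: measurable_funD; apply: measurable_funM => //;
  by apply/measurable_EFinP; exact: measurable_F_state.
- by move=> t _; rewrite lee_fin state_linear//; exact: F_convex.
Qed.

(** Equality holds at every time and not merely almost everywhere, which makes time 0 usable for
    strict convexity of the value. *)
Lemma state_cost_convex_eq x y u v (a b : R) : 0 <= a -> 0 <= b -> a + b = 1 ->
  control u -> control v ->
  (state_cost x u < +oo)%E -> (state_cost y v < +oo)%E ->
  (a%:E * state_cost x u + b%:E * state_cost y v <=
   state_cost (a *: x + b *: y)%R (fun t => a * u t + b * v t)%R)%E ->
  forall t, horizon T t ->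
    F (a *: state x u t + b *: state y v t) = a * F (state x u t) + b * F (state y v t).
Proof.
move=> a0 b0 ab cu cv fu fv h t Tt.
have cw := control_convex a0 b0 ab cu cv.
rewrite -state_linear//.
apply: (@continuous_integral_ge _ T (fun t => F (state _ (fun t => a * u t + b * v t) t))
  (fun t => a * F (state x u t) + b * F (state y v t))) => //.
- exact: continuous_F_state.
- move=> s; apply: cvgD; apply: cvgMr; exact: continuous_F_state.
- by move=> s; rewrite F_ge0/= state_linear//; exact: F_convex.
- by rewrite integral_convex_combination.
- apply: le_lt_trans (state_cost_convex _ _ a0 b0 ab cu cv) _.
  by rewrite lte_add_pinfty// lte_mul_pinfty.
Qed.

Lemma exists_minimal_control x : exists2 u, control u &
  forall v, control v -> (state_cost x u <= state_cost x v)%E.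
Proof.
pose A := [set state_cost x u | u in control].
have [u0 cu0 fu0] := exists_finite_cost x.
have A0 : (0 <= ereal_inf A)%E.
  by apply: le_ereal_inf_tmp => _ [u _ <-]; exact: state_cost_ge0.
have Afin : ereal_inf A \is a fin_num.
  rewrite ge0_fin_numE//; apply: le_lt_trans fu0.
  by apply: ereal_inf_lbound; exists u0.
have h0 : 0 <= 2^-1 :> R by lra.
have half : 2^-1 + 2^-1 = 1 :> R by lra.
pose C m := [set u | control u /\
  (state_cost x u <= ereal_inf A + (m.+1%:R^-1)%:E)%E].
have [||m k mk u [cu uk]|m u v [cu um] [cv vm]|v_ [v [Cv cv vv]]] := @ae_limit_nested_convex R C.
- move=> m; have [||_ [u cu <-] uA] := @lb_ereal_inf_adherent _ A (m.+1%:R^-1) => //.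
  by exists u; split => //; exact: ltW.
- by move=> m u [].
- split => //; apply: le_trans uk _; rewrite leeD2l// lee_fin.
  by rewrite lef_pV2 ?posrE// ler_nat.
- split; first by apply: control_convex.
  (* Writing [x] as the midpoint of itself lets joint convexity apply with a fixed initial state. *)
  rewrite /= [x in state_cost x _](_ : _ = 2^-1 *: x + 2^-1 *: x); last first.
    by rewrite -scalerDl half scale1r.
  apply: le_trans (state_cost_convex x x h0 h0 half cu cv) _.
  move: um vm; set c := (_ + _)%E => um vm.
  have -> : c = (2^-1%:E * c + 2^-1%:E * c)%E.
    by rewrite -ge0_muleDl ?lee_fin// -EFinD half mul1e.
  by apply: leeD; apply: lee_wpmul2l; rewrite ?lee_fin.
exists v => // w cw.
apply: (@le_trans _ _ (ereal_inf A)); last by apply: ereal_inf_lbound; exists w.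
apply/lee_addgt0Pr => e e0.
have [N Ne] : exists N, N.+1%:R^-1 <= e.
  exists (Num.truncn e^-1); rewrite -[leRHS]invrK lef_pV2 ?posrE ?invr_gt0//.
  by apply: ltW; apply: truncnS_gt.
(* Dropping the first [N] controls puts all costs within [e] of the infimum and keeps the limit. *)
apply: (@state_cost_lsc x (fun m => v_ (m + N)%N)) => //.
- by move=> m; case: (Cv (m + N)%N).
- apply: filterS vv; first exact: (ae_filter_ringOfSetsType mu).
  by move=> t vt; rewrite (cvg_shiftn N (v_ ^~ t)).
- move=> m; have [_ h] := Cv (m + N)%N; apply: le_trans h _.
  rewrite leeD2l// lee_fin; apply: le_trans Ne.
  by rewrite lef_pV2 ?posrE// ler_nat ltnS leq_addl.
Qed.

End Convex.
End Cost.

(** * Recovering a control from its primitive *)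

Section Uniqueness.
Context {R : realType}.
Local Notation mu := (@lebesgue_measure R).

Lemma locally_bounded_locally_integrable (f : R -> R) :
  locally_bounded_measurable f -> locally_integrable setT f.
Proof.
move=> lf; split; [by case: lf|exact: openT|move=> K _ cK].
have [M [_ KM]] := compact_bounded cK.
have KI : K `<=` `[- (`|M| + 1), `|M| + 1].
  move=> t Kt; rewrite /= in_itv/= -ler_norml; apply: KM => //.
  by rewrite (le_lt_trans (ler_norm M))// ltrDl.
have /integrableP[_] := integrable_itvcc (- (`|M| + 1)) (`|M| + 1) lf.
have [mf _] := lf.
apply: le_lt_trans; apply: ge0_subset_integral => //.
- exact: compact_measurable.
- by apply/measurable_EFinP; apply: measurableT_comp => //; exact: measurable_funTS.
Qed.

Lemma primitive_eq_ae (T : \bar R) (u v : R -> R) :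
  locally_bounded_measurable u -> locally_bounded_measurable v ->
  (forall t, horizon T t -> primitive u t = primitive v t) ->
  {ae mu, forall t, horizon T t -> u t = v t}.
Proof.
move=> lu lv uv; pose f t := u t - v t.
have lf : locally_bounded_measurable f.
  split; first by apply: measurable_funB; [case: lu|case: lv].
  move=> N; have [_ /(_ N)[M1 uM]] := lu; have [_ /(_ N)[M2 vM]] := lv.
  exists (M1 + M2) => s sN; apply: le_trans (ler_normB _ _) _.
  by rewrite lerD ?uM ?vM.
have f0 t : horizon T t -> primitive f t = 0.
  move=> Tt; rewrite /primitive RintegralB//; [|exact: integrable_itvcc..].
  by have := uv _ Tt; rewrite /primitive => ->; rewrite subrr.
have fi y : mu.-integrable [set` Interval (BLeft 0) (BRight y)] (EFin \o f).
  exact: integrable_itvcc.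
have ae0 := @FTC1 _ f (BLeft 0) fi (locally_bounded_locally_integrable lf).
have ae1 : {ae mu, forall t, t != 0}.
  exists [set 0]; split => //; first exact: lebesgue_measure_set1.
  by move=> t /= /negP; rewrite negbK => /eqP.
apply: filterS2 ae0 ae1; first exact: (ae_filter_ringOfSetsType mu).
move=> t dt tn0 Tt; have [t_ge0 _] := Tt.
have t0 : 0 < t by rewrite lt_neqAle eq_sym tn0.
have [|_ ft] := dt; first by rewrite lte_fin.
apply/eqP; rewrite -subr_eq0 -/(f t) -ft derive1E.
(* The primitive is 0 on a full neighbourhood of [t]: up to [s] on the right, and by default at
   nonpositive times. *)
rewrite (@near_eq_derive _ _ _ _ (cst 0)) ?derive_cst//.
have [s ts Ts] := horizon_right Tt.
near=> r; have rs : r < s by near: r; exact: lt_nbhsl.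
have [r0|r0] := leP r 0; first exact: (primitive_le0 f r0).
by apply: f0; apply: (horizon_itv Ts); rewrite /= in_itv/= !ltW.
Unshelve. all: by end_near. Qed.
End Uniqueness.

Theorem theorem7p1 (R : realType) (n : nat) (n_gt0 : (0 < n)%N)
    (F : 'cV[R]_n -> R) (F_C1 : continuously_differentiable F)
    (F_convex : convex F) (F_posdef : positive_definite F)
    (T : \bar R) (T_gt0 : (0 < T)%E) :
  [/\ forall x0 : 'cV[R]_n, exists u : R -> R, is_minimizer F T x0 u,
      forall x0 : 'cV[R]_n, value F T x0 \is a fin_num,
      positive_definite (fun x0 : 'cV[R]_n => fine (value F T x0)) &
      convex (fun x0 : 'cV[R]_n => fine (value F T x0))] /\
  (strictly_convex F ->
    (forall x0 : 'cV[R]_n,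
      (exists u : R -> R, is_minimizer F T x0 u) /\
      (forall u v : R -> R, is_minimizer F T x0 u -> is_minimizer F T x0 v ->
        {ae lebesgue_measure, forall t, horizon T t -> u t = v t})) /\
    strictly_convex (fun x0 : 'cV[R]_n => fine (value F T x0))).
Proof.
have F_cont : continuous F by move=> x; apply: differentiable_continuous; case: F_C1.
have [F0 F_gt0] := F_posdef.
have F_ge0 x : 0 <= F x by have [->|/F_gt0/ltW//] := eqVneq x 0; rewrite F0.
move/convex_functionP in F_convex.
pose J := state_cost F T.
have /choice[m mP] : forall x, exists u, control u /\
    forall v, control v -> (J x u <= J x v)%E.
  by move=> x; have [u cu uJ] := exists_minimal_control T F_cont F_ge0 F0 F_convex x; exists u.
have cm x : control (m x) by case: (mP x).
have Jm x v : control v -> (J x (m x) <= J x v)%E by case: (mP x) => _; apply.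
have m_min x : is_minimizer F T x (m x).
  split; first exact: admissible_control.
  move=> v av; rewrite cost_control// cost_restrict//.
  by apply: Jm; exact: control_restrict.
have valueE x u : is_minimizer F T x u -> value F T x = cost F T x u.
  move=> [au uv]; apply/eqP; rewrite eq_le; apply/andP; split.
    by apply: ereal_inf_lbound; exists u.
  by apply: le_ereal_inf_tmp => _ [v av <-]; exact: uv.
have VE x : value F T x = J x (m x) by rewrite (valueE _ _ (m_min x)) cost_control.
have J_ge0 x u : (0 <= J x u)%E by exact: state_cost_ge0.
have Jm_lty x : (J x (m x) < +oo)%E.
  have [u cu] := exists_finite_cost T F_cont F_ge0 F0 x.
  by apply: le_lt_trans; exact: Jm.
have Vfin x : value F T x \is a fin_num by rewrite VE ge0_fin_numE.
have VK x : (fine (value F T x))%:E = J x (m x) by rewrite fineK.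
pose w a b x y t : R := a * m x t + b * m y t.
have V_le a b x y : 0 <= a -> 0 <= b -> a + b = 1 ->
    (J (a *: x + b *: y)%R (m (a *: x + b *: y)%R) <= J (a *: x + b *: y)%R (w a b x y))%E.
  by move=> a0 b0 ab; apply: Jm; exact: control_convex.
split; first split => //.
- by move=> x; exists (m x).
- split.
    have c0 : control (cst 0 : R -> R) by split => // t; rewrite normr0.
    have J0 : J 0 (cst 0) = 0%E.
      rewrite /J /state_cost -[RHS](@integral0 _ _ _ lebesgue_measure (horizon T)).
      apply: eq_integral => t _; congr EFin.
      (* Linearity with zero coefficients shows that the zero control keeps the state at the
         origin. *)
      have := state_linear 0 0 0 0 t c0 c0 (n := n).
      rewrite !scale0r addr0; under [X in state _ X]eq_fun do rewrite mul0r addr0.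
      by move=> ->; rewrite F0.
    have := Jm 0 _ c0; rewrite J0 => J00.
    by apply: EFin_inj; rewrite VK; apply/eqP; rewrite eq_le J00 J_ge0.
  (* A zero value would force the running cost to vanish at time 0, where the state is [x]. *)
  move=> x x0; rewrite -lte_fin VK lt_neqAle J_ge0 andbT; apply/negP => /eqP J0.
  have J0' : (J x (m x) <= 0)%E by rewrite -J0.
  have := integral_continuous_eq0 (continuous_F_state F_cont (cm x)) _ J0' (horizon0 T_gt0).
  by rewrite state0 => /(_ (fun=> F_ge0 _)) Fx0; have := F_gt0 _ x0; rewrite Fx0 ltxx.
- apply/convex_functionP => a b x y a0 b0 ab.
  rewrite -lee_fin EFinD !EFinM !VK; apply: le_trans (V_le _ _ _ _ a0 b0 ab) _.
  exact: state_cost_convex.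
move=> F_strict; split; last first.
  (* At time 0 the states are [x] and [y] whatever the controls; a failure of strictness would give
     equality in the convexity inequality of [F] at these points. *)
  move=> x y t xy t0 t1; rewrite ltNge; apply/negP => h.
  have t0' := ltW t0; have t1' : 0 <= 1 - t by rewrite subr_ge0 ltW.
  have tt : t + (1 - t) = 1 by rewrite addrC subrK.
  have := F_strict _ _ _ xy t0 t1.
  have := state_cost_convex_eq F_cont F_ge0 F_convex (x := x) (y := y) t0' t1' tt
    (cm x) (cm y) (Jm_lty x) (Jm_lty y) _ (horizon0 T_gt0).
  rewrite !state0 => ->; first by rewrite ltxx.
  apply: le_trans (V_le _ _ x y t0' t1' tt).
  by move: h; rewrite -lee_fin EFinD !EFinM !VK.
move=> x; split; first by exists (m x).
move=> u v minu minv; have [au _] := minu; have [av _] := minv.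
pose u' := u \_ (horizon T); pose v' := v \_ (horizon T).
have cu : control u' := control_restrict au.
have cv : control v' := control_restrict av.
have Ju : J x u' = J x (m x) by rewrite -VE (valueE _ _ minu) cost_restrict.
have Jv : J x v' = J x (m x) by rewrite -VE (valueE _ _ minv) cost_restrict.
have h0 : 0 < 2^-1 :> R by rewrite invr_gt0.
have half : 2^-1 + 2^-1 = 1 :> R by lra.
have xx : 2^-1 *: x + 2^-1 *: x = x by rewrite -scalerDl half scale1r.
(* The midpoint of two optimal controls cannot cost less than they do, so the convexity inequality
   for the cost is an equality. *)
have eqF := state_cost_convex_eq (T := T) F_cont F_ge0 F_convex (x := x) (y := x)
  (ltW h0) (ltW h0) half cu cv.
have halfJ : (2^-1%:E * J x (m x) + 2^-1%:E * J x (m x) = J x (m x))%E.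
  by rewrite -ge0_muleDl ?lee_fin ?(ltW h0)// -EFinD half mul1e.
rewrite -/J Ju Jv xx halfJ in eqF.
have {}eqF := eqF (Jm_lty x) (Jm_lty x) (Jm _ _ (control_convex (ltW h0) (ltW h0) half cu cv)).
have uv t : horizon T t -> state x u' t = state x v' t.
  move=> Tt; apply/eqP; apply: contraT => ne.
  have h1 : 2^-1 < 1 :> R by lra.
  have := F_strict _ _ _ ne h0 h1; have -> : 1 - 2^-1 = 2^-1 :> R by lra.
  by rewrite eqF// ltxx.
have lbm (z : R -> R) : control z -> locally_bounded_measurable z.
  by move=> cz; exact: (locally_bounded_chain (fun=> 0) 0 cz).
(* The last coordinate of the state is the first chain element: an initial value plus the primitive
   of the control. *)
have puv t : horizon T t -> primitive u' t = primitive v' t.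
  move=> /uv /matrixP/(_ (Ordinal (ltac:(by rewrite ltn_predL) : (n.-1 < n)%N)) 0).
  rewrite !mxE/= (_ : (n - n.-1)%N = 1%N)/=; last lia.
  exact: addrI.
have uv_ae := primitive_eq_ae (lbm _ cu) (lbm _ cv) puv.
apply: filterS uv_ae; first exact: (ae_filter_ringOfSetsType (@lebesgue_measure R)).
by move=> t huv Tt; have := huv Tt; rewrite /u' /v' !patchE !mem_set.
Qed.
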